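(* Let the data set $P$, the regions $E_{ij}$, the domains $\tilde E_k$, the assignment $\gamma$, the maps $\vec L_{ij}$, the contractivity factors $s_{ij},s_{ij}',\tilde s_{ij},\tilde s_{ij}'$, the functions $q_{ij},\tilde q_{ij}$, the maps $\vec F_{ij}$, the bounded set $D\subset\mathbb R^2$ and the transformations $\vec W_{ij}:\tilde E_k\times D\to E_{ij}\times\mathbb R^2$ ($i=1,\dots,n$, $j=1,\dots,m$, $k=\gamma(i,j)$) be as described in the context, and let $$\overline S=\max\{\overline{s}_{ij}+\overline{\tilde s}_{ij},\ \overline{s'}_{ij}+\overline{\tilde s'}_{ij}\ :\ i=1,\dots,n,\ j=1,\dots,m\}.$$ If $\overline S<1$, then there exists a distance $\rho_\theta$ on $\mathbb R^4$, equivalent to the Euclidean metric, such that every $\vec W_{ij}$ ($i=1,\dots,n$, $j=1,\dots,m$) is a contraction transformation with respect to $\rho_\theta$.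
   Context: Data: $P=\{(x_i,y_j,z_{ij},t_{ij})=(\vec x_{ij},\vec z_{ij})\in\mathbb R^4: i=0,\dots,n,\ j=0,\dots,m\}$ with $x_0<x_1<\dots<x_n$, $y_0<y_1<\dots<y_m$, $\vec x_{ij}=(x_i,y_j)$, $\vec z_{ij}=(z_{ij},t_{ij})$ (the $z_{ij}$ are given data values, the $t_{ij}$ are arbitrary real parameters). Put $N=nm$, $E=[x_0,x_n]\times[y_0,y_m]$, $I_{x_i}=[x_{i-1},x_i]$, $I_{y_j}=[y_{j-1},y_j]$ and $E_{ij}=I_{x_i}\times I_{y_j}$ for $1\le i\le n$, $1\le j\le m$ (the ''regions''). Domains: $l$ is an integer with $2\le l\le N$. For $k=1,\dots,l$, $\tilde E_k=\tilde I_{x,k}\times\tilde I_{y,k}\subset E$ is a rectangle (a ''domain'') with $\tilde I_{x,k}=[x_{s_x(k)},x_{e_x(k)}]$, $\tilde I_{y,k}=[y_{s_y(k)},y_{e_y(k)}]$, where $s_x(k),e_x(k)\in\{0,\dots,n\}$, $s_y(k),e_y(k)\in\{0,\dots,m\}$, $e_x(k)-s_x(k)\ge2$ and $e_y(k)-s_y(k)\ge2$. For each $(i,j)\in\{1,\dots,n\}\times\{1,\dots,m\}$ an index $k=\gamma(i,j)\in\{1,\dots,l\}$ is chosen; below $k$ always means $\gamma(i,j)$. Maps $\vec L_{ij}$: $L_{x_i,k}:\tilde I_{x,k}\to I_{x_i}$ and $L_{y_j,k}:\tilde I_{y,k}\to I_{y_j}$ are contraction homeomorphisms (homeomorphisms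 that are Lipschitz with constant less than 1) mapping the set of endpoints onto the set of endpoints: $L_{x_i,k}(\{x_{s_x(k)},x_{e_x(k)}\})=\{x_{i-1},x_i\}$, $L_{y_j,k}(\{y_{s_y(k)},y_{e_y(k)}\})=\{y_{j-1},y_j\}$. For $\vec x=(x,y)\in\tilde E_k$, $\vec L_{ij}(\vec x)=(L_{x_i,k}(x),L_{y_j,k}(y))\in E_{ij}$. Maps $\vec F_{ij}$: $\vec F_{ij}:\tilde E_k\times\mathbb R^2\to\mathbb R^2$ is defined, for $\vec z=(z,t)$, by $$\vec F_{ij}(\vec x,\vec z)=\begin{pmatrix} s_{ij}(\vec L_{ij}(\vec x))\,z+s_{ij}'(\vec L_{ij}(\vec x))\,t+q_{ij}(\vec x)\\ \tilde s_{ij}(\vec L_{ij}(\vec x))\,z+\tilde s_{ij}'(\vec L_{ij}(\vec x))\,t+\tilde q_{ij}(\vec x)\end{pmatrix},$$ where $s_{ij},s_{ij}',\tilde s_{ij},\tilde s_{ij}':E_{ij}\to\mathbb R$ are Lipschitz functions whose absolute values are less than 1 (here $'$ is only a label, not a derivative), and $q_{ij},\tilde q_{ij}:\tilde E_k\to\mathbb R$ are Lipschitz functions such that: whenever $\alpha\in\{s_x(k),e_x(k)\}$, $\beta\in\{s_y(k),e_y(k)\}$, $a\in\{i-1,i\}$, $b\in\{j-1,j\}$, $L_{x_i,k}(x_\alpha)=x_a$ and $L_{y_j,k}(y_\beta)=y_b$, one has $\vec F_{ij}(\vec x_{\alpha\beta},\vec z_{\alpha\beta})=\vec z_{ab}$.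 Transformations: $D\subset\mathbb R^2$ is a (sufficiently large) bounded set containing all $\vec z_{ij}$, $i=0,\dots,n$, $j=0,\dots,m$, and $\vec W_{ij}:\tilde E_k\times D\to E_{ij}\times\mathbb R^2$, $\vec W_{ij}(\vec x,\vec z)=(\vec L_{ij}(\vec x),\vec F_{ij}(\vec x,\vec z))$. Notation: for a function $f$, $\overline f=\max|f|$ over the domain of $f$; thus $\overline{s}_{ij}=\max_{E_{ij}}|s_{ij}|$, $\overline{s'}_{ij}=\max_{E_{ij}}|s_{ij}'|$, $\overline{\tilde s}_{ij}=\max_{E_{ij}}|\tilde s_{ij}|$, $\overline{\tilde s'}_{ij}=\max_{E_{ij}}|\tilde s_{ij}'|$. A contraction transformation is a Lipschitz map with Lipschitz constant less than 1. *)

(* Defs.v *)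
From mathcomp Require Export all_boot all_order all_algebra.
From mathcomp Require Export all_classical all_reals all_analysis.

Set Implicit Arguments.
Unset Strict Implicit.
Unset Printing Implicit Defensive.

Export Order.TTheory GRing.Theory Num.Theory.
Export numFieldNormedType.Exports.
Local Open Scope classical_set_scope.
Local Open Scope ring_scope.

(* The region index i = 1, ..., n is encoded as i : 'I_n, shifted down by one:
   region i lies between the nodes node_lo i and node_hi i, i.e. the nodes
   number i - 1 and i (for the unshifted i) among 0, ..., n. *)
Definition node_lo n (i : 'I_n) : 'I_n.+1 := widen_ord (leqnSn n) i.
Definition node_hi n (i : 'I_n) : 'I_n.+1 := lift ord0 i.

Section Defs.
Context {R : realType}.

(* Functions on a subset A are total functions of which only the values on A
   matter. *)
Definition homeomorphism_between (A B : set R) (f : R -> R) : Prop :=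
  exists g : R -> R,
    [/\ f @` A = B, g @` B = A, {in A, cancel f g}, {in B, cancel g f}
      & {within A, continuous f} /\ {within B, continuous g}].

Definition contraction_homeomorphism (A B : set R) (f : R -> R) : Prop :=
  homeomorphism_between A B f /\ exists2 c : R, 0 <= c < 1 & c.-lipschitz_A f.

(* The greatest element of A (0 if there is none). *)
Definition set_max (A : set R) : R := xget 0 (A `&` ubound A).

Definition max_abs T (A : set T) (f : T -> R) : R :=
  set_max [set `|f p| | p in A].

Definition map_L (Lx Ly : R -> R) (p : R * R) : R * R := (Lx p.1, Ly p.2).

Definition map_F (L : R * R -> R * R) (s s' st st' q qt : R * R -> R)
    (p v : R * R) : R * R :=
  (s (L p) * v.1 + s' (L p) * v.2 + q p,
   st (L p) * v.1 + st' (L p) * v.2 + qt p).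

(* R^4 is (R * R) * (R * R): ((x, y), (z, t)). *)
Definition map_W (L : R * R -> R * R) (F : R * R -> R * R -> R * R)
    (P : (R * R) * (R * R)) : (R * R) * (R * R) := (L P.1, F P.1 P.2).

Definition is_distance T (rho : T -> T -> R) : Prop :=
  [/\ forall p q, 0 <= rho p q,
      forall p q, rho p q = 0 <-> p = q,
      forall p q, rho p q = rho q p
    & forall p q r, rho p r <= rho p q + rho q r].

(* The norm of the library on products is the sup norm, hence the explicit
   formula. *)
Definition euclidean_dist4 (P Q : (R * R) * (R * R)) : R :=
  Num.sqrt ((P.1.1 - Q.1.1) ^+ 2 + (P.1.2 - Q.1.2) ^+ 2
          + (P.2.1 - Q.2.1) ^+ 2 + (P.2.2 - Q.2.2) ^+ 2).

(* Equivalence of metrics in the usual sense of fractal geometry: each is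
   bounded by a constant multiple of the other (in particular they induce the
   same topology). *)
Definition equivalent_dist T (rho d : T -> T -> R) : Prop :=
  exists c1 c2 : R,
    [/\ 0 < c1, 0 < c2 & forall p q, c1 * d p q <= rho p q <= c2 * d p q].

Definition contraction_wrt T (rho : T -> T -> R) (A : set T) (f : T -> T) :=
  exists2 c : R, 0 <= c < 1 &
    forall p q, A p -> A q -> rho (f p) (f q) <= c * rho p q.

End Defs.

(* Main.v *)
Require Import Defs.
From mathcomp Require Import ring lra.

(* Give the data coordinates a small weight theta > 0: take the distance
   rho_theta = |dx| + |dy| + theta (|dz| + |dt|). The coefficients of F_ij are
   Lipschitz and D is bounded, hence
   |dF|_1 <= Sbar (|dz| + |dt|) + K (|dx| + |dy|), and W_ij contracts rho_theta
   by the factor max (c + theta K, Sbar), where c < 1 is a contraction factor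
   of L_ij. The factor is < 1 once theta K < 1 - c, which holds for all of the
   finitely many (i, j) as soon as theta is small enough. *)

Set Implicit Arguments.
Unset Strict Implicit.
Unset Printing Implicit Defensive.

Local Open Scope classical_set_scope.
Local Open Scope ring_scope.

(** * Weighted taxicab distances on R^4 *)

Section TaxicabDistance.
Context {R : realType}.
Implicit Types (p q r : R * R) (P Q : (R * R) * (R * R)).

Definition dist1 p q : R := `|p.1 - q.1| + `|p.2 - q.2|.

Definition rho_theta (theta : R) P Q : R :=
  dist1 P.1 Q.1 + theta * dist1 P.2 Q.2.

Lemma dist1_ge0 p q : 0 <= dist1 p q.
Proof. by rewrite addr_ge0. Qed.

Lemma dist1_eq0 p q : dist1 p q = 0 -> p = q.
Proof.
case: p q => [p1 p2] [q1 q2] /eqP; rewrite paddr_eq0// !normr_eq0 !subr_eq0 /=.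
by case/andP => /eqP -> /eqP ->.
Qed.

Lemma dist1xx p : dist1 p p = 0.
Proof. by rewrite /dist1 !subrr normr0 addr0. Qed.

Lemma dist1C p q : dist1 p q = dist1 q p.
Proof. by rewrite /dist1 distrC [X in _ + X]distrC. Qed.

Lemma dist1_triangle p q r : dist1 p r <= dist1 p q + dist1 q r.
Proof. by rewrite addrACA lerD// ler_distD. Qed.

(** Links [dist1] to the sup norm of the product, in which the Lipschitz hypotheses are
    expressed. *)
Lemma norm_le_dist1 p q : `|p - q| <= dist1 p q.
Proof. by rewrite prod_normE /= ge_max lerDl lerDr !normr_ge0. Qed.

Lemma is_distance_rho_theta (theta : R) :
  0 < theta -> is_distance (rho_theta theta).
Proof.
move=> th0; have thge0 := ltW th0; split=> [P Q|[P1 P2] [Q1 Q2]|P Q|P Q S].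
- by rewrite addr_ge0// ?mulr_ge0// dist1_ge0.
- split=> [/eqP|->]; last by rewrite /rho_theta !dist1xx mulr0 addr0.
  rewrite paddr_eq0 ?mulr_ge0 ?dist1_ge0//= mulf_eq0 (gt_eqF th0) /=.
  by case/andP => /eqP/dist1_eq0 -> /eqP/dist1_eq0 ->.
- by rewrite /rho_theta dist1C [X in theta * X]dist1C.
- by rewrite addrACA lerD ?dist1_triangle// -mulrDr ler_wpM2l// dist1_triangle.
Qed.

Lemma euclidean_dist4_le P Q :
  euclidean_dist4 P Q <= dist1 P.1 Q.1 + dist1 P.2 Q.2.
Proof.
have d0 : 0 <= dist1 P.1 Q.1 + dist1 P.2 Q.2 by rewrite addr_ge0 ?dist1_ge0.
rewrite -[leRHS]ger0_norm// -sqrtr_sqr ler_sqrt ?sqr_ge0// /dist1.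
(* With squares of absolute values, the claim becomes a^2 + b^2 + c^2 + d^2 <= (a + b + c + d)^2 for
   nonnegative reals. *)
rewrite -(real_normK (num_real (P.1.1 - _))) -(real_normK (num_real (P.1.2 - _))).
rewrite -(real_normK (num_real (P.2.1 - _))) -(real_normK (num_real (P.2.2 - _))).
move: (normr_ge0 (P.1.1 - Q.1.1)) (normr_ge0 (P.1.2 - Q.1.2)).
move: (normr_ge0 (P.2.1 - Q.2.1)) (normr_ge0 (P.2.2 - Q.2.2)).
by move: `|_| `|_| `|_| `|_| => a b c d ????; nra.
Qed.

(** Each coordinate difference is at most the Euclidean distance, and [dist1] adds two of them. *)
Lemma dist1_le_euclidean_dist4 P Q :
  dist1 P.1 Q.1 <= 2 * euclidean_dist4 P Q /\
  dist1 P.2 Q.2 <= 2 * euclidean_dist4 P Q.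
Proof.
have le_sqrt (a e : R) : a ^+ 2 <= e -> `|a| <= Num.sqrt e.
  by move=> ae; rewrite -sqrtr_sqr ler_wsqrtr.
have := sqr_ge0 (P.1.1 - Q.1.1); have := sqr_ge0 (P.1.2 - Q.1.2).
have := sqr_ge0 (P.2.1 - Q.2.1); have := sqr_ge0 (P.2.2 - Q.2.2).
move=> *; rewrite !mulr_natl !mulr2n.
by split; apply: lerD; apply: le_sqrt; lra.
Qed.

Lemma equivalent_dist_rho_theta (theta : R) : 0 < theta ->
  equivalent_dist (rho_theta theta) euclidean_dist4.
Proof.
(* The lower constant is the smaller of the weights 1 and [theta]; the upper one adds the bound 2
   for each block, with its weight. *)
move=> th0; exists (Num.min 1 theta), (2 + theta * 2).
split=> [||P Q]; first by rewrite lt_min ltr01.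
  by rewrite addr_gt0// mulr_gt0.
have d1 := dist1_ge0 P.1 Q.1; have d2 := dist1_ge0 P.2 Q.2.
apply/andP; split; last first.
  have [h1 h2] := dist1_le_euclidean_dist4 P Q.
  by rewrite mulrDl -mulrA lerD// ler_wpM2l// ltW.
apply: (@le_trans _ _ (Num.min 1 theta * (dist1 P.1 Q.1 + dist1 P.2 Q.2))).
  by rewrite ler_wpM2l ?euclidean_dist4_le// le_min ler01 ltW.
rewrite mulrDr lerD// ?ler_wpM2r ?ge_min ?lexx ?orbT//.
by rewrite ler_piMl// ge_min lexx.
Qed.

(** The conclusion holds for all small positive [theta], not just for one, so that finitely many
    maps can later share the same [theta]. *)
Lemma map_W_contraction (A D : set (R * R)) (L : R * R -> R * R)
    (F : R * R -> R * R -> R * R) (c S K : R) :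
  0 <= c < 1 -> S < 1 -> 0 <= K ->
  (forall p q, A p -> A q -> dist1 (L p) (L q) <= c * dist1 p q) ->
  (forall p q v w, A p -> A q -> D v -> D w ->
    dist1 (F p v) (F q w) <= S * dist1 v w + K * dist1 p q) ->
  \forall theta \near 0^'+,
    contraction_wrt (rho_theta theta) (A `*` D) (map_W L F).
Proof.
move=> /andP[c0 c1] S1 K0 Lc FK.
(* [K] may be 0, so the bound on [theta] divides by [K + 1]. *)
have K1 : 0 < K + 1 by rewrite ltr_wpDl.
near=> theta.
have th0 : 0 < theta by near: theta; exact: nbhs_right_gt.
have thK : c + theta * K < 1.
  have : theta < (1 - c) / (K + 1).
    by near: theta; apply: nbhs_right_lt; rewrite divr_gt0// subr_gt0.
  by rewrite ltr_pdivlMr// => ?; nra.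
(* The first argument already makes this factor nonnegative. *)
exists (Num.max (c + theta * K) S).
  by rewrite gt_max thK S1 le_max addr_ge0// mulr_ge0// ltW.
move=> [p v] [q w] [/= Ap Dv] [/= Aq Dw]; rewrite /rho_theta /=.
have := Lc _ _ Ap Aq; have := FK _ _ _ _ Ap Aq Dv Dw.
rewrite -(ler_pM2l th0) => dF dL; apply: (le_trans (lerD dL dF)).
(* The cross term [theta * K * dist1 p q] is absorbed into the part of the distance that has weight
   1. *)
rewrite [leLHS](_ : _ =
  (c + theta * K) * dist1 p q + S * (theta * dist1 v w)); last by ring.
rewrite [leRHS]mulrDr lerD// ler_wpM2r ?le_max ?lexx ?orbT ?dist1_ge0//.
by rewrite mulr_ge0 ?dist1_ge0// ltW.
Unshelve. all: by end_near. Qed.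

End TaxicabDistance.

(** * Lipschitz estimates for L_ij and F_ij *)

Section Lipschitz.
Context {R : realType}.

Lemma lipschitz_in_dist1 (A : set (R * R)) (f : R * R -> R) :
  [lipschitz f p | p in A] -> exists2 k : R, 0 <= k &
    forall p q, A p -> A q -> `|f p - f q| <= k * dist1 p q.
Proof.
case/pinfty_ex_gt0 => k k0 fk; exists k; first exact: ltW.
move=> p q Ap Aq; apply: le_trans (fk (p, q) (conj Ap Aq)) _.
by rewrite ler_wpM2l ?norm_le_dist1// ltW.
Qed.

Lemma lipschitz_within_continuous (V W : normedModType R) (A : set V)
    (f : V -> W) :
  [lipschitz f p | p in A] -> {within A, continuous f}.
Proof.
case/pinfty_ex_gt0 => k k0 fk; apply/subspace_continuousP => x Ax.
apply/cvgrPdist_lt => e e0; near=> y.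
have Ay : A y by near: y; exact: withinT.
apply: le_lt_trans (fk (x, y) (conj Ax Ay)) _; rewrite /= mulrC -ltr_pdivlMr//.
near: y; apply: cvg_within; apply: cvgr_dist_lt; [exact: cvg_id|].
exact: divr_gt0.
Unshelve. all: by end_near. Qed.

(** By continuity and compactness the maximum is attained, so [set_max] returns a true greatest
    element and not its default 0. *)
Lemma le_max_abs (V : normedModType R) (A : set V) (f : V -> R) p :
  compact A -> [lipschitz f p | p in A] -> A p -> `|f p| <= max_abs A f.
Proof.
move=> cA fl Ap.
have nfc : {within A, continuous (fun q => `|f q|)}.
  move=> q; apply: continuous_comp; last exact: norm_continuous.
  exact: lipschitz_within_continuous.
have [c Ac fc] := compact_EVT_max (ex_intro _ p Ap) cA nfc.
rewrite /max_abs /set_max; set B := [set _ | _ in A].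
have /xgetPex : exists y, (B `&` ubound B) y.
  exists `|f c|; split; first by exists c => //; rewrite inE in Ac.
  by move=> _ [q Aq <-]; apply: fc; rewrite inE.
by move=> /(_ 0)[_]; apply; exists p.
Qed.

Lemma map_L_contraction (A B A' B' : set R) (f g : R -> R) :
  contraction_homeomorphism A A' f -> contraction_homeomorphism B B' g ->
  exists2 c : R, 0 <= c < 1 & forall p q, (A `*` B) p -> (A `*` B) q ->
    dist1 (map_L f g p) (map_L f g q) <= c * dist1 p q.
Proof.
move=> [_ [a /andP[a0 a1] fa]] [_ [b /andP[b0 b1] gb]].
exists (Num.max a b); first by rewrite gt_max a1 b1 le_max a0.
move=> p q [Ap Bp] [Aq Bq]; rewrite /dist1 /= mulrDr lerD//.
  apply: le_trans (fa (p.1, q.1) (conj Ap Aq)) _ => /=.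
  by rewrite ler_wpM2r// le_max lexx.
apply: le_trans (gb (p.2, q.2) (conj Bp Bq)) _ => /=.
by rewrite ler_wpM2r// le_max lexx orbT.
Qed.

Lemma map_L_image (A B A' B' : set R) (f g : R -> R) p :
  contraction_homeomorphism A A' f -> contraction_homeomorphism B B' g ->
  (A `*` B) p -> (A' `*` B') (map_L f g p).
Proof.
move=> [[f' [fA _ _ _ _]] _] [[g' [gB _ _ _ _]] _] [Ap Bp].
by split; rewrite /= -?fA -?gB; [exists p.1|exists p.2].
Qed.

(** The increments of [u] and [v] keep the coefficients of the first point, while the increments of
    the coefficients meet only the bounded values [u'] and [v']. *)
Lemma affine_dist_le (a a' b b' u u' v v' c c' M : R) :
  `|u'| <= M -> `|v'| <= M ->
  `|(a * u + b * v + c) - (a' * u' + b' * v' + c')| <=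
  `|a| * `|u - u'| + `|b| * `|v - v'|
  + (M * `|a - a'| + M * `|b - b'| + `|c - c'|).
Proof.
move=> uM vM.
rewrite [X in `|X|](_ : _ = a * (u - u') + b * (v - v')
  + (u' * (a - a') + v' * (b - b') + (c - c'))); last by ring.
rewrite -!normrM; apply: le_trans (ler_normD _ _) _.
apply: lerD; first exact: ler_normD.
apply: le_trans (ler_normD _ _) _; apply: lerD => //.
apply: le_trans (ler_normD _ _) _.
by rewrite !normrM; apply: lerD; rewrite ler_wpM2r.
Qed.

(** Adding the two rows of F_ij in the taxicab norm produces the column sums |s| + |st| and |s'| +
    |st'| as factors of |dz| and |dt|. The variation of the coefficients goes into [K], which is
    finite because [D] is bounded. *)
Lemma map_F_dist1_le (A E D : set (R * R)) (L : R * R -> R * R)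
    (s s' st st' q qt : R * R -> R) (S : R) :
  (forall p, A p -> E (L p)) ->
  (forall p1 p2, A p1 -> A p2 -> dist1 (L p1) (L p2) <= dist1 p1 p2) ->
  [lipschitz s p | p in E] -> [lipschitz s' p | p in E] ->
  [lipschitz st p | p in E] -> [lipschitz st' p | p in E] ->
  [lipschitz q p | p in A] -> [lipschitz qt p | p in A] ->
  (forall p, E p -> `|s p| + `|st p| <= S) ->
  (forall p, E p -> `|s' p| + `|st' p| <= S) ->
  bounded_set D ->
  exists2 K : R, 0 <= K & forall p1 p2 v w, A p1 -> A p2 -> D v -> D w ->
    dist1 (map_F L s s' st st' q qt p1 v) (map_F L s s' st st' q qt p2 w)
    <= S * dist1 v w + K * dist1 p1 p2.
Proof.
move=> LE Lle /lipschitz_in_dist1[k1 k1_ge0 sk] /lipschitz_in_dist1[k2 k2_ge0 s'k].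
move=> /lipschitz_in_dist1[k3 k3_ge0 stk] /lipschitz_in_dist1[k4 k4_ge0 st'k].
move=> /lipschitz_in_dist1[k5 k5_ge0 qk] /lipschitz_in_dist1[k6 k6_ge0 qtk].
move=> sS s'S /pinfty_ex_gt0[M /ltW M0 DM].
(* One group of three terms per row of F_ij: [M] bounds the coordinates of points of [D], and the
   [k]s are the Lipschitz constants. *)
exists (M * k1 + M * k2 + k5 + (M * k3 + M * k4 + k6)).
  by rewrite !addr_ge0// mulr_ge0.
move=> p1 p2 v w A1 A2 Dv Dw.
have [wM1 wM2] : `|w.1| <= M /\ `|w.2| <= M.
  by apply/andP; have := DM _ Dw; rewrite /= prod_normE ge_max.
have E1 := LE _ A1; have E2 := LE _ A2.
(* The coefficients are evaluated at [L p]; as [L] does not expand distances, composing with it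
   preserves the Lipschitz constant. *)
have lift (f : R * R -> R) (k : R) : 0 <= k ->
    (forall p q, E p -> E q -> `|f p - f q| <= k * dist1 p q) ->
    M * `|f (L p1) - f (L p2)| <= M * k * dist1 p1 p2.
  move=> k0 /(_ _ _ E1 E2) fk; rewrite -mulrA ler_wpM2l//.
  by apply: le_trans fk _; rewrite ler_wpM2l// Lle.
rewrite [leLHS]/dist1 /=.
apply: le_trans (lerD (affine_dist_le _ _ _ _ _ _ _ _ wM1 wM2)
                      (affine_dist_le _ _ _ _ _ _ _ _ wM1 wM2)) _.
have := lift _ _ k1_ge0 sk; have := lift _ _ k2_ge0 s'k.
have := lift _ _ k3_ge0 stk; have := lift _ _ k4_ge0 st'k.
have := qk _ _ A1 A2; have := qtk _ _ A1 A2.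
have := ler_wpM2r (normr_ge0 (v.1 - w.1)) (sS _ E1).
have := ler_wpM2r (normr_ge0 (v.2 - w.2)) (s'S _ E1).
rewrite [in S * _]/dist1 !mulrDl mulrDr; lra.
Qed.

End Lipschitz.

Theorem theorem3 (R : realType) (n m l : nat)
  (* data points *)
  (x : 'I_n.+1 -> R) (y : 'I_m.+1 -> R) (z t : 'I_n.+1 -> 'I_m.+1 -> R)
  (x_incr : forall a b : 'I_n.+1, (a < b)%N -> x a < x b)
  (y_incr : forall a b : 'I_m.+1, (a < b)%N -> y a < y b)
  (* domains *)
  (l_bounds : (2 <= l <= n * m)%N)
  (sx ex : 'I_l -> 'I_n.+1) (sy ey : 'I_l -> 'I_m.+1)
  (domx : forall k, (sx k + 2 <= ex k)%N)
  (domy : forall k, (sy k + 2 <= ey k)%N)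
  (gamma : 'I_n -> 'I_m -> 'I_l)
  (Ix := fun i : 'I_n => `[x (node_lo i), x (node_hi i)]%classic : set R)
  (Iy := fun j : 'I_m => `[y (node_lo j), y (node_hi j)]%classic : set R)
  (E := fun i j => Ix i `*` Iy j)
  (tIx := fun k : 'I_l => `[x (sx k), x (ex k)]%classic : set R)
  (tIy := fun k : 'I_l => `[y (sy k), y (ey k)]%classic : set R)
  (tE := fun k => tIx k `*` tIy k)
  (* maps L_ij *)
  (Lx : 'I_n -> 'I_l -> R -> R) (Ly : 'I_m -> 'I_l -> R -> R)
  (Lx_contr : forall i j, let k := gamma i j in
    contraction_homeomorphism (tIx k) (Ix i) (Lx i k))
  (Ly_contr : forall i j, let k := gamma i j in
    contraction_homeomorphism (tIy k) (Iy j) (Ly j k))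
  (Lx_ends : forall i j, let k := gamma i j in
    Lx i k @` [set x (sx k); x (ex k)] = [set x (node_lo i); x (node_hi i)])
  (Ly_ends : forall i j, let k := gamma i j in
    Ly j k @` [set y (sy k); y (ey k)] = [set y (node_lo j); y (node_hi j)])
  (L := fun i j => map_L (Lx i (gamma i j)) (Ly j (gamma i j)))
  (* maps F_ij *)
  (s s' st st' q qt : 'I_n -> 'I_m -> R * R -> R)
  (s_lip : forall i j, [lipschitz s i j p | p in E i j])
  (s'_lip : forall i j, [lipschitz s' i j p | p in E i j])
  (st_lip : forall i j, [lipschitz st i j p | p in E i j])
  (st'_lip : forall i j, [lipschitz st' i j p | p in E i j])
  (s_lt1 : forall i j p, E i j p -> `|s i j p| < 1)
  (s'_lt1 : forall i j p, E i j p -> `|s' i j p| < 1)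
  (st_lt1 : forall i j p, E i j p -> `|st i j p| < 1)
  (st'_lt1 : forall i j p, E i j p -> `|st' i j p| < 1)
  (q_lip : forall i j, [lipschitz q i j p | p in tE (gamma i j)])
  (qt_lip : forall i j, [lipschitz qt i j p | p in tE (gamma i j)])
  (F := fun i j =>
    map_F (L i j) (s i j) (s' i j) (st i j) (st' i j) (q i j) (qt i j))
  (F_interp : forall i j (alpha a : 'I_n.+1) (beta b : 'I_m.+1),
    let k := gamma i j in
    alpha \in [:: sx k; ex k] -> beta \in [:: sy k; ey k] ->
    a \in [:: node_lo i; node_hi i] -> b \in [:: node_lo j; node_hi j] ->
    Lx i k (x alpha) = x a -> Ly j k (y beta) = y b ->
    F i j (x alpha, y beta) (z alpha beta, t alpha beta) = (z a b, t a b))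
  (* transformations W_ij *)
  (D : set (R * R)) (D_bounded : bounded_set D)
  (D_data : forall a b, D (z a b, t a b))
  (W := fun i j => map_W (L i j) (F i j))
  (* 0 is neutral below: all terms are nonnegative and n, m > 0 *)
  (Sbar := \big[Num.max/0]_(i < n) \big[Num.max/0]_(j < m)
     Num.max (max_abs (E i j) (s i j) + max_abs (E i j) (st i j))
             (max_abs (E i j) (s' i j) + max_abs (E i j) (st' i j))) :
  Sbar < 1 ->
  exists rho : (R * R) * (R * R) -> (R * R) * (R * R) -> R,
    [/\ is_distance rho,
        equivalent_dist rho euclidean_dist4
      & forall i j, contraction_wrt rho (tE (gamma i j) `*` D) (W i j)].
Proof.
move=> Sbar_lt1.
(* Pointwise column sums are at most the sums of the separate maxima, which are among the terms of
   [Sbar]. *)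
have SbarP i j p : E i j p ->
    `|s i j p| + `|st i j p| <= Sbar /\ `|s' i j p| + `|st' i j p| <= Sbar.
  move=> Ep.
  have cE : compact (E i j) by apply: compact_setX; exact: segment_compact.
  apply/andP; rewrite -ge_max.
  apply: le_trans (le_bigmax _ _ i); apply: le_trans (le_bigmax _ _ j).
  by apply: le_max2; apply: lerD; exact: le_max_abs.
(* The quantifier over (i, j) goes inside the filter because the index types are finite; this gives
   one [theta] for all maps. *)
have near_contr : \forall theta \near (0 : R)^'+, forall i j,
    contraction_wrt (rho_theta theta) (tE (gamma i j) `*` D) (W i j).
  apply: filter_forall => i; apply: filter_forall => j.
  have [c /andP[c0 c1] Lc] := map_L_contraction (Lx_contr i j) (Ly_contr i j).
  have [||||K K0 FK] := @map_F_dist1_le R (tE (gamma i j)) (E i j) D (L i j)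
      (s i j) (s' i j) (st i j) (st' i j) (q i j) (qt i j) Sbar _ _ (s_lip i j)
      (s'_lip i j) (st_lip i j) (st'_lip i j) (q_lip i j) (qt_lip i j) _ _ D_bounded.
  - by move=> p; exact: map_L_image.
  - move=> p1 p2 A1 A2; apply: le_trans (Lc _ _ A1 A2) _.
    by rewrite ler_piMl ?dist1_ge0// ltW.
  - by move=> p /SbarP[].
  - by move=> p /SbarP[].
  - by apply: map_W_contraction Lc FK; rewrite ?c0.
near (0 : R)^'+ => theta.
have theta_gt0 : 0 < theta by near: theta; exact: nbhs_right_gt.
exists (rho_theta theta); split.
- exact: is_distance_rho_theta.
- exact: equivalent_dist_rho_theta.
- by near: theta.
Unshelve. all: by end_near. Qed.
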